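(* Let $S$ be a semigroup and let $T$ be a subsemigroup of $S$ of finite Green index. If $S$ is automatic, then $T$ is automatic.
   Context: For a semigroup $S$, $S^1=S\cup\{1\}$ denotes $S$ with a new identity element $1\notin S$ adjoined; for $X\subseteq S$, $X^1=X\cup\{1\}$. For a subsemigroup $T$ of $S$ and $u,v\in S$: $u\,\mathscr{R}^T v$ iff $uT^1=vT^1$; $u\,\mathscr{L}^T v$ iff $T^1u=T^1v$; $\mathscr{H}^T=\mathscr{R}^T\cap\mathscr{L}^T$. Each $\mathscr{H}^T$-class lies wholly in $T$ or wholly in $S\setminus T$. The Green index of $T$ in $S$ is one more than the number of $\mathscr{H}^T$-classes contained in $S\setminus T$. Let $A$ be a finite alphabet representing a generating set for a semigroup $S$; a word $w\in A^+$ represents an element $\overline{w}\in S$, and for $K\subseteq A^+$, $\overline{K}=\{\overline{w}:w\in K\}$. Let $\$\notin A$ be a padding symbol. The map $\delta:A^+\times A^+\to\big((A\cup\{\$\})\times(A\cup\{\$\})\setminus\{(\$,\$)\}\big)^+$ sends $(u_1\cdots u_m,v_1\cdots v_n)$ to the word obtained by padding the shorter of the two words on the right with symbols $\$$ to equal length and reading the two words letter by letter in parallel as a word of pairs. Let $L\subseteq A^+$ be a regular language with $\overline{L}=S$. For $w\in A^*$ let $L_w=\{(u,v):u,v\in L,\ \overline{uw}=\overline{v}\}$. The pair $(A,L)$ is an automatic structure for $S$ if the language $L_a\delta$ is regular for every $a\in A\cup\{\varepsilon\}$, where $\varepsilon$ is the empty word. A semigroup is automatic if it admits an automatic structure. 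*)

(* Defs.v *)
From HB Require Import structures.
From mathcomp Require Import all_boot.
From mathcomp Require Import all_classical.

Set Implicit Arguments.
Unset Strict Implicit.
Unset Printing Implicit Defensive.

Local Open Scope classical_set_scope.

Section RegularLanguages.
Variable A : Type.

Record dfa := Dfa {
  dfa_state : finType;
  dfa_init : dfa_state;
  dfa_final : pred dfa_state;
  dfa_step : dfa_state -> A -> dfa_state }.

Definition dfa_accepts (M : dfa) (w : seq A) : bool :=
  dfa_final (foldl (dfa_step (d := M)) (dfa_init M) w).

Definition regular (L : set (seq A)) : Prop :=
  exists M : dfa, L = [set w | dfa_accepts M w].

End RegularLanguages.

Section Padding.
Variable A : finType.

(* [None] plays the role of the padding symbol. *)
Definition padded_letter : finType :=
  {p : option A * option A | p != (None, None)}.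

Definition pad_both (a b : A) : padded_letter := Sub (Some a, Some b) isT.
Definition pad_right (a : A) : padded_letter := Sub (Some a, None) isT.
Definition pad_left (b : A) : padded_letter := Sub (None, Some b) isT.

Fixpoint padded (u v : seq A) : seq padded_letter :=
  match u, v with
  | a :: u', b :: v' => pad_both a b :: padded u' v'
  | _ :: _, [::] => map pad_right u
  | [::], _ => map pad_left v
  end.

End Padding.

Section AdjoinedIdentity.
Variable S : semigroupType.

(* The operation of S^1, represented as [option S] with [None] as the new
   identity; it is adjoined even when S already has one. *)
Definition mul1 (x y : option S) : option S :=
  match x, y with
  | None, _ => y
  | _, None => x
  | Some s, Some t => Some (s * t)%g
  end.

Definition adjoin1 (X : set S) : set (option S) := None |` (Some @` X).

End AdjoinedIdentity.

Section RelativeGreen.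
Variables (S : semigroupType) (T : set S).

Definition right_translates (u : S) : set (option S) :=
  [set mul1 (Some u) t | t in adjoin1 T].

Definition left_translates (u : S) : set (option S) :=
  [set mul1 t (Some u) | t in adjoin1 T].

Definition greenR (u v : S) : Prop := right_translates u = right_translates v.
Definition greenL (u v : S) : Prop := left_translates u = left_translates v.
Definition greenH (u v : S) : Prop := greenR u v /\ greenL u v.

Definition outer_greenH_classes : set (set S) :=
  [set C | (exists u, C = [set v | greenH u v]) /\ C `<=` ~` T].

(* The Green index is one more than the cardinality of this set. *)
Definition finite_green_index : Prop := finite_set outer_greenH_classes.

End RelativeGreen.

Section Subsemigroup.
Variables (S : semigroupType) (T : set S).
Hypothesis mulT : mulg_closed (mem T).

Definition subsemigroup_type of mulg_closed (mem T) : Type := {x : S | x \in T}.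

HB.instance Definition _ := [isSub of subsemigroup_type mulT for @sval S _].
HB.instance Definition _ := [Choice of subsemigroup_type mulT by <:].
HB.instance Definition _ :=
  SubChoice_isSubSemigroup.Build S (mem T) (subsemigroup_type mulT) mulT.

End Subsemigroup.

Section Automatic.
Variables (S : semigroupType) (A : finType) (gen : A -> S).

(* The element represented by a word, computed in S^1: the empty word gives
   [None], and every nonempty word gives [Some] of the product of its letters
   in S. *)
Definition eval_word (w : seq A) : option S :=
  foldr (fun a x => mul1 (Some (gen a)) x) None w.

Definition mult_rel (L : set (seq A)) (w : seq A) : set (seq A * seq A) :=
  [set uv | [/\ L uv.1, L uv.2 & eval_word (uv.1 ++ w) = eval_word uv.2]].

Definition padded_lang (K : set (seq A * seq A)) : set (seq (padded_letter A)) :=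
  [set padded uv.1 uv.2 | uv in K].

(* The second condition, [eval_word @` L = S], implies that [gen] enumerates
   a generating set of S; [gen] need not be injective. *)
Definition automatic_structure (L : set (seq A)) : Prop :=
  [/\ ~ L [::], eval_word @` L = [set Some s | s in [set: S]], regular L,
      regular (padded_lang (mult_rel L [::]))
    & forall a : A, regular (padded_lang (mult_rel L [:: a]))].

End Automatic.

Definition automatic (S : semigroupType) : Prop :=
  exists (A : finType) (gen : A -> S) (L : set (seq A)),
    automatic_structure gen L.

(* Main.v *)
Require Import Defs.
From mathcomp Require Import all_boot.
From mathcomp Require Import all_classical.
From mathcomp Require Import zify.

(** Why T inherits automaticity.

    Pick representatives h_i of the finitely many H^T-classes outside T, and put
    h = 1 for one extra index. Every element of S lies in T or is R^T-related to
    some h_i, so for a letter a one has a h_j = h_j' tau with tau in T^1; reading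
    a word w from right to left gives w = h_j0 tau_1 ... tau_n. In the same way
    h_k tau = theta h_k' with theta in T^1, and this expression can be read from
    left to right. As L^T is a right congruence, k names the L^T-class of the
    prefix until the prefix enters T; from then on it is the index of 1. So if w
    represents an element of T, the last index is that of 1 and
    w = theta_1 ... theta_n ([trace_of_word]). Adding the state of an automaton for L, the passage from
    w to the theta's is governed by a finite set of states, one between any two
    consecutive letters ([run], [trace]). Only finitely many theta are needed.

    The theta may be the identity of T^1, which a semigroup T has no letter for,
    and deleting such letters would shift the two tapes of a synchronous
    automaton by unbounded amounts. Instead, let p be the number of states and
    take a shortest trace with a given value. A stretch of p letters in it whose
    theta's are all 1 would visit a state twice and could be shortened, so each
    stretch of p letters has a value in T itself ([geodesic_block]). A letter of
    the new alphabet is a block of letters of w, of length p except for the last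
    one, which has length at most 2p, together with the states at its two ends;
    its value is an element of T.

    The new language K is then given by conditions on consecutive letters, hence
    regular, and concatenating blocks maps K into L without changing the element
    represented ([block_lang_sound]). So the multiplication relations of K are
    pulled back from the relations {(u, v) in L x L : u x = v} with x in S^1,
    along a map that replaces letters by blocks of fixed length, the last one
    aside. These relations are compositions of those of the generators of S
    ([sync_mul_rel]), and both operations keep relations recognisable by
    synchronous automata ([sync_comp], [sync_blocks]). *)

Set Implicit Arguments.
Unset Strict Implicit.
Unset Printing Implicit Defensive.

Local Open Scope classical_set_scope.

(** * Synchronous relations and padded languages *)

(** Both tapes, cut or padded with None to length N. Unlike [padded],
    this can be split at any position ([conv_cat]). *)
Fixpoint conv (A : Type) (N : nat) (u v : seq A) : seq (option A * option A) :=
  if N is N'.+1 then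
    (ohead u, ohead v) :: conv N' (behead u) (behead v)
  else [::].

(** Acceptance must not depend on how many trailing (None, None) are read; this
    removes all case distinctions on which word is the longer one. *)
Definition sync_regular (A : Type) (R : set (seq A * seq A)) : Prop :=
  exists M : dfa (option A * option A)%type,
  forall (u v : seq A) N, size u <= N -> size v <= N ->
    dfa_accepts M (conv N u v) <-> R (u, v).

Lemma conv_cat (A : Type) m n (u v : seq A) :
  conv (m + n) u v = conv m u v ++ conv n (drop m u) (drop m v).
Proof.
elim: m u v => [|m IH] u v /=; first by rewrite !drop0.
by rewrite IH -!drop1 !drop_drop !addn1.
Qed.

Lemma conv_take (A : Type) n (u v : seq A) :
  conv n (take n u) (take n v) = conv n u v.
Proof.
elim: n u v => // n IH [|a u] [|b v] //=; congr (_ :: _); rewrite -[RHS]IH.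
all: by case: n {IH}.
Qed.

Lemma conv_nil (A : Type) n : conv n [::] [::] = nseq n (@None A, @None A).
Proof. by elim: n => //= n ->. Qed.

Lemma conv_extend (A : Type) N K (u v : seq A) : size u <= N -> size v <= N ->
  conv (N + K) u v = conv N u v ++ nseq K (None, None).
Proof. by move=> hu hv; rewrite conv_cat !drop_oversize // conv_nil. Qed.

Section PaddedWords.
Variable A : finType.
Implicit Types (u v : seq A) (z : seq (padded_letter A)).

Lemma padded_cons u v : (u != [::]) || (v != [::]) ->
  exists2 c : padded_letter A, val c = (ohead u, ohead v) &
    padded u v = c :: padded (behead u) (behead v).
Proof.
case: u v => [|a u] [|b v] //= _.
- by exists (pad_left b) => //; case: v.
- by exists (pad_right a) => //; case: u.
- by exists (pad_both a b).
Qed.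

Lemma pmap_conv u v N : size u <= N -> size v <= N ->
  pmap insub (conv N u v) = padded u v.
Proof.
elim: N u v => [|N IH] u v; first by case: u v => [|//] [].
move=> hu hv /=; have {IH}IH : pmap insub (conv N (behead u) (behead v))
    = padded (behead u) (behead v).
  by apply: IH; rewrite size_behead; [case: u hu {hv}|case: v hv {hu}].
case: (boolP ((u != [::]) || (v != [::]))) => [/padded_cons[c hc ->]|].
  by rewrite -hc valK /= IH.
rewrite negb_or !negbK => /andP[/eqP eu /eqP ev]; subst u v.
by rewrite insubN //= IH.
Qed.

Lemma padded_conv u v : map val (padded u v) = conv (maxn (size u) (size v)) u v.
Proof.
move: {2}(maxn _ _) (erefl (maxn (size u) (size v))) => N.
elim: N u v => [|N IH] u v.
  by case: u v => [|a u] [|b v]; rewrite //= ?max0n ?maxn0 // maxnSS.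
move=> hN; case: (boolP ((u != [::]) || (v != [::]))).
  move=> /padded_cons[c hc ->]; rewrite hN /= hc IH.
    congr (_ :: conv _ _ _); rewrite !size_behead.
    by case: u v hN {hc} => [|a u] [|b v]; rewrite ?max0n ?maxn0 ?maxnSS //= => -[].
  rewrite !size_behead.
  by case: u v hN {hc} => [|a u] [|b v]; rewrite ?max0n ?maxn0 ?maxnSS //= => -[].
by rewrite negb_or !negbK => /andP[/eqP eu /eqP ev]; subst u v.
Qed.

Definition left_word z : seq A := pmap (fun c : padded_letter A => (val c).1) z.
Definition right_word z : seq A := pmap (fun c : padded_letter A => (val c).2) z.

Lemma left_word_padded u v : left_word (padded u v) = u.
Proof.
elim: u v => [|a u IH] [|b v] //; rewrite /left_word //=.
- by elim: v.
- by congr (_ :: _); elim: u {IH} => //= c u ->.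
- by congr (_ :: _); exact: IH.
Qed.

Lemma right_word_padded u v : right_word (padded u v) = v.
Proof.
elim: u v => [|a u IH] [|b v] //; rewrite /right_word //=.
- by congr (_ :: _); elim: v => //= c v ->.
- by elim: u {IH}.
- by congr (_ :: _); exact: IH.
Qed.

(** The letters (None, None), which can only trail, are skipped. *)
Lemma sync_of_padded (R : set (seq A * seq A)) :
  regular (padded_lang R) -> sync_regular R.
Proof.
case=> M hM.
pose st (q : dfa_state M) (c : option A * option A) :=
  if insub c is Some d then dfa_step q d else q.
exists (Dfa (dfa_init M) (@dfa_final _ M) st) => u v N hu hv.
have -> : dfa_accepts (Dfa (dfa_init M) (@dfa_final _ M) st) (conv N u v)
    = dfa_accepts M (padded u v).
  rewrite /dfa_accepts /= -(pmap_conv hu hv); congr dfa_final.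
  elim: (conv N u v) (dfa_init M) => //= c w IH q.
  by rewrite IH /st; case: (insub c).
have -> : dfa_accepts M (padded u v) <-> padded_lang R (padded u v) by rewrite hM.
split=> [[[u' v'] /= h e]|h]; last by exists (u, v).
have <- : u' = u by rewrite -(left_word_padded u' v') e left_word_padded.
by have <- : v' = v by rewrite -(right_word_padded u' v') e right_word_padded.
Qed.

(** A word of pairs comes from a padded pair iff no letter follows a pad in the
    same tape; the two flags record the tapes that have ended. *)
Definition well_padded_step (s : option (bool * bool)) (c : option A * option A) :=
  if s is Some (e, f) then
    if (e ==> ~~ c.1) && (f ==> ~~ c.2) then Some (~~ c.1, ~~ c.2) else None
  else None.

Lemma well_padded_dead w : foldl well_padded_step None w = None.
Proof. by elim: w. Qed.

Lemma well_paddedP z e f :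
  foldl well_padded_step (Some (e, f)) (map val z) <->
  [/\ z = padded (left_word z) (right_word z),
      e -> left_word z = [::] & f -> right_word z = [::]].
Proof.
split.
  elim: z e f => [|[[oa ob] hc] z IH] e f //=.
  case: ifP => [/andP[/= he hf]|_]; last by rewrite well_padded_dead.
  move/IH=> [hz h1 h2].
  rewrite /left_word /right_word /= -/(left_word z) -/(right_word z).
  case: oa ob hc he hf h1 h2 => [a|] [b|] //= hc he hf h1 h2.
  - split; [|by case: (e) he|by case: (f) hf].
    by rewrite [in LHS]hz; congr (_ :: _); apply/val_inj.
  - rewrite h2 //; split=> //; last by case: (e) he.
    rewrite [in LHS]hz h2 //;
      by case: (left_word z) => [|x u] /=; congr (_ :: _); apply/val_inj.
  - rewrite h1 //; split=> //; last by case: (f) hf.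
    rewrite [in LHS]hz h1 //;
      by case: (right_word z) => [|x u] /=; congr (_ :: _); apply/val_inj.
move: (left_word z) (right_word z) => u v [-> he hf] {z}.
rewrite padded_conv; move: (maxn _ _) => N.
elim: N u v e f he hf => // N IH u v e f he hf /=.
have -> : (e ==> ~~ ohead u) && (f ==> ~~ ohead v).
  by apply/andP; split; apply/implyP; [move/he->|move/hf->].
by apply: IH; [case: u {he}|case: v {hf}].
Qed.

(** Besides running the synchronous automaton, one has to reject the words that
    are not padded pairs at all. *)
Lemma padded_of_sync (R : set (seq A * seq A)) :
  sync_regular R -> regular (padded_lang R).
Proof.
case=> M hM.
pose st (s : dfa_state M * option (bool * bool)) (c : padded_letter A) :=
  (dfa_step s.1 (val c), well_padded_step s.2 (val c)).
exists (Dfa (dfa_init M, Some (false, false))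
            (fun s => dfa_final s.1 && s.2) st).
have run z s : foldl st s z =
    (foldl (@dfa_step _ M) s.1 (map val z), foldl well_padded_step s.2 (map val z)).
  by elim: z s => [|c z IH] [] //= *; rewrite IH.
apply/seteqP; split=> z /=; rewrite /dfa_accepts /= run /=.
  move=> [[u v] /= h <-]; apply/andP; split; last first.
    by apply/well_paddedP; rewrite left_word_padded right_word_padded.
  by rewrite padded_conv; apply/hM; rewrite ?leq_maxl ?leq_maxr.
move=> /andP[h /well_paddedP[hz _ _]]; exists (left_word z, right_word z) => //=.
by move: h; rewrite hz padded_conv; move/hM; rewrite left_word_padded right_word_padded;
  apply; rewrite ?leq_maxl ?leq_maxr.
Qed.

End PaddedWords.

(** * Operations on synchronous relations *)

Section SyncClosure.
Variable A : Type.
Implicit Types (u v w : seq A) (R : set (seq A * seq A)).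

Definition rel_comp R1 R2 : set (seq A * seq A) :=
  [set uw | exists v, R1 (uw.1, v) /\ R2 (v, uw.2)].

Section Composition.
Variables M1 M2 : dfa (option A * option A)%type.

(** Subset construction on runs that guess the middle word; the boolean says
    that this word has ended. *)
Definition comp_state : finType := (dfa_state M1 * dfa_state M2 * bool)%type.

Definition comp_step (X : {ffun comp_state -> bool}) (c : option A * option A) :=
  [ffun t : comp_state => `[< exists s ob, [/\ X s, s.2 -> ob = None &
     t = (dfa_step s.1.1 (c.1, ob), dfa_step s.1.2 (ob, c.2), ~~ isSome ob)] >]].

Lemma comp_stepE N u w X t :
  foldl comp_step X (conv N u w) t <->
  exists s v, [/\ X s, s.2 -> v = [::], size v <= N &
    t = (foldl (@dfa_step _ M1) s.1.1 (conv N u v),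
         foldl (@dfa_step _ M2) s.1.2 (conv N v w), s.2 || (size v < N))].
Proof.
elim: N u w X => [|N IH] u w X /=.
  split=> [Xt|[s [v [Xs _ _ ->]]]].
    by exists t, [::]; split => //; rewrite orbF; case: t {Xt} => [[]].
  by rewrite ltn0 orbF; case: s Xs => [[]].
apply: iff_trans (IH _ _ _) _; split.
  move=> [s' [v' [Xs' hs' hv' ->]]]; move: Xs'; rewrite ffunE => /asboolP.
  move=> [s [[b|] [Xs hs es']]]; subst s'; exists s.
    exists (b :: v'); split => //=; first by move/hs.
    by case: (s.2) hs => // /(_ isT).
  by rewrite (hs' isT); exists [::]; split => //=; rewrite orbT.
move=> [s [v [Xs hs hv ->]]].
exists (dfa_step s.1.1 (ohead u, ohead v), dfa_step s.1.2 (ohead v, ohead w),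
        ~~ isSome (ohead v)), (behead v); split => /=.
- rewrite ffunE; apply/asboolP; exists s, (ohead v); split=> //.
  by move/hs ->.
- by case: v {hs hv}.
- by rewrite size_behead; case: v hv {hs}.
- by case: v hs {hv} => [|b v] //= hs; rewrite ?orbT //; case: (s.2) hs => // /(_ isT).
Qed.

End Composition.

(** The middle word may be longer than the two outer words, so a set of states
    accepts when some number of further (None, None) leads to success. *)
Lemma sync_comp R1 R2 : sync_regular R1 -> sync_regular R2 ->
  sync_regular (rel_comp R1 R2).
Proof.
move=> [M1 h1] [M2 h2].
pose X0 : {ffun comp_state M1 M2 -> bool} :=
  [ffun s => s == (dfa_init M1, dfa_init M2, false)].
pose good (X : {ffun comp_state M1 M2 -> bool}) :=
  exists s, [/\ X s, dfa_final s.1.1 & dfa_final s.1.2].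
exists (Dfa X0 (fun X => `[< exists K, good (foldl (@comp_step M1 M2) X
                                     (nseq K (None, None))) >])
            (@comp_step M1 M2)) => u w N hu hw.
rewrite /dfa_accepts /=.
have -> : `[< exists K, good (foldl (@comp_step M1 M2)
    (foldl (@comp_step M1 M2) X0 (conv N u w)) (nseq K (None, None))) >]
  <-> exists K, good (foldl (@comp_step M1 M2) X0 (conv (N + K) u w)).
  by split=> [/asboolP[K h]|[K h]]; [|apply/asboolP]; exists K; move: h;
    rewrite conv_extend // foldl_cat.
split=> [[K [t [/comp_stepE[s [v [hs _ hv ->]]] /= f1 f2]]]|[v [/= r1 r2]]].
  move: hs; rewrite ffunE => /eqP es; subst s.
  have hK : N <= N + K by rewrite leq_addr.
  by exists v; split; [apply/(h1 _ _ (N + K))|apply/(h2 _ _ (N + K))] => //;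
    apply: leq_trans hK.
(* After size v further pads the whole of v has been read. *)
exists (size v).
exists (foldl (@dfa_step _ M1) (dfa_init M1) (conv (N + size v) u v),
  foldl (@dfa_step _ M2) (dfa_init M2) (conv (N + size v) v w), size v < N + size v).
have hv : size v <= N + size v by rewrite leq_addl.
have hN : N <= N + size v by rewrite leq_addr.
split=> /=; last 2 first.
- by apply/h1 => //; apply: leq_trans hN.
- by apply/h2 => //; apply: leq_trans hN.
by apply/comp_stepE; exists (dfa_init M1, dfa_init M2, false), v; split => //;
  rewrite ffunE.
Qed.

(** Asking P to be correct on K only matters for [sync_blocks], whose automaton
    fails on words with blocks of the wrong length. *)
Lemma sync_restrict (K : set (seq A)) R : regular K ->
  (exists P : dfa (option A * option A)%type, forall u v N, K u -> K v ->
     size u <= N -> size v <= N -> dfa_accepts P (conv N u v) <-> R (u, v)) ->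
  sync_regular [set uv | [/\ K uv.1, K uv.2 & R uv]].
Proof.
move=> [M ->] [P hP].
pose st (o : dfa_state M) (oa : option A) := if oa is Some a then dfa_step o a else o.
exists (Dfa (dfa_init M, dfa_init M, dfa_init P)
  (fun s => [&& dfa_final s.1.1, dfa_final s.1.2 & dfa_final s.2])
  (fun s c => (st s.1.1 c.1, st s.1.2 c.2, dfa_step s.2 c))) => u v N hu hv.
have run s :
  foldl (fun s c => (st s.1.1 c.1, st s.1.2 c.2, dfa_step s.2 c)) s (conv N u v) =
    (foldl (@dfa_step _ M) s.1.1 u, foldl (@dfa_step _ M) s.1.2 v,
     foldl (@dfa_step _ P) s.2 (conv N u v)).
  elim: N u v s hu hv => [|N IH] u v s /=; first by case: u v s => [|//] [|//] [[]].
  move=> hu hv; rewrite IH /=; last 2 first.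
  - by rewrite size_behead; case: u hu.
  - by rewrite size_behead; case: v hv.
  by case: u v {hu hv} => [|a u] [|b v].
rewrite /dfa_accepts /= run /=; split=> [/and3P[a b c]|[a b c]].
  by split => //; apply/(hP _ _ N).
by apply/and3P; split => //; apply/(hP _ _ N).
Qed.

End SyncClosure.

(** * Pulling back along blocks *)

Lemma insub_bseqK n (T : Type) (s : seq T) :
  size s <= n -> insub_bseq n s = s :> seq T.
Proof. by move=> h; rewrite /insub_bseq insubdK. Qed.

Section Blocks.
Variables (A C : finType) (block : C -> seq A) (p B : nat).
Hypothesis size_block : forall c, size (block c) <= p + B.
Implicit Types (c d : seq C) (u v : seq A).

Definition blocks c : seq A := flatten (map block c).

(** The last block is exempt: [sorted] only tests letters that have a
    successor. *)
Definition full_blocks c : bool := sorted (fun x _ => size (block x) == p) c.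

Lemma full_blocks_cons x c : full_blocks (x :: c) ->
  (c = [::] \/ size (block x) = p) /\ full_blocks c.
Proof.
rewrite /full_blocks; case: c => [|y c] /=; first by split=> //; left.
by move=> /andP[/eqP ? ?]; split=> //; right.
Qed.

Lemma size_blocks c : full_blocks c -> size (blocks c) <= p * size c + B.
Proof.
elim: c => // x c IH /full_blocks_cons[hx /IH]; rewrite /blocks /= size_cat.
have := size_block x; case: hx => [->|->]; rewrite /= mulnS; lia.
Qed.

Definition oblock (o : option C) : seq A := if o is Some c then block c else [::].

Section Automaton.
Variable M : dfa (option A * option A)%type.

Definition buffer : finType := {bseq B of A}.

(** Each step advances M by exactly p pairs. Only a last block can be longer than
    p; its surplus waits in the buffer, and [block_final] flushes it. *)
Definition block_step (s : dfa_state M * buffer * buffer)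
    (c : option C * option C) : dfa_state M * buffer * buffer :=
  let u := (s.1.2 : seq A) ++ oblock c.1 in
  let v := (s.2 : seq A) ++ oblock c.2 in
  (foldl (@dfa_step _ M) s.1.1 (conv p u v),
   insub_bseq B (drop p u), insub_bseq B (drop p v)).

Definition block_final (s : dfa_state M * buffer * buffer) : bool :=
  dfa_final (foldl (@dfa_step _ M) s.1.1 (conv B s.1.2 s.2)).

(** One step on one tape: a nonempty buffer occurs only when no letter is left,
    and this property is preserved. *)
Lemma ohead_blocks c (b : buffer) : c = [::] \/ b = [::] :> seq A -> full_blocks c ->
  let u := (b : seq A) ++ oblock (ohead c) in
  [/\ size (drop p u) <= B, behead c = [::] \/ drop p u = [::],
      full_blocks (behead c) &
      let w := (b : seq A) ++ blocks c in
        take p w = take p u /\ drop p w = drop p u ++ blocks (behead c)].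
Proof.
move=> hb; case: c hb => [|x c] hb.
  move=> _ /=; rewrite /blocks /= !cats0; split=> //; last by left.
  by rewrite size_drop; have := size_bseq b; lia.
case: hb => // hb /full_blocks_cons[hx hc] /=; rewrite hb /= /blocks /= -/(blocks c).
have hd : c = [::] \/ drop p (block x) = [::].
  by case: hx => h; [left|right; rewrite drop_oversize // h].
split=> //; first by rewrite size_drop; have := size_block x; lia.
case: hx => hx; first by rewrite hx /blocks /= !cats0.
rewrite take_cat drop_cat hx ltnn subnn take0 drop0 cats0.
by rewrite take_oversize ?drop_oversize ?hx.
Qed.

Lemma block_run N (c d : seq C) q (bu bv : buffer) :
  size c <= N -> size d <= N -> full_blocks c -> full_blocks d ->
  c = [::] \/ bu = [::] :> seq A -> d = [::] \/ bv = [::] :> seq A ->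
  block_final (foldl block_step (q, bu, bv) (conv N c d)) =
  dfa_final (foldl (@dfa_step _ M) q
    (conv (p * N + B) ((bu : seq A) ++ blocks c) ((bv : seq A) ++ blocks d))).
Proof.
elim: N c d q bu bv => [|N IH] c d q bu bv hc hd fc fd ec ed.
  case: c hc {fc ec} => // _; case: d hd {fd ed} => // _.
  by rewrite /block_final /blocks /= !cats0 muln0.
have [su bu' fc' hu] := ohead_blocks ec fc.
have [sv bv' fd' hv] := ohead_blocks ed fd.
rewrite /= IH //; last 4 first.
- by rewrite size_behead; lia.
- by rewrite size_behead; lia.
- by rewrite insub_bseqK.
- by rewrite insub_bseqK.
rewrite !insub_bseqK // mulnS -addnA [in RHS]conv_cat foldl_cat.
have [tu du] := hu; have [tv dv] := hv.
by rewrite du dv -(conv_take p (_ ++ blocks c)) tu tv conv_take.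
Qed.

End Automaton.

Lemma sync_blocks (K : set (seq C)) (R : set (seq A * seq A)) :
  regular K -> K `<=` [set c | full_blocks c] -> sync_regular R ->
  sync_regular [set cd | [/\ K cd.1, K cd.2 & R (blocks cd.1, blocks cd.2)]].
Proof.
move=> regK fullK [M hM].
apply: (sync_restrict (R := [set cd | R (blocks cd.1, blocks cd.2)]) regK).
exists (Dfa (dfa_init M, [bseq] : buffer, [bseq] : buffer) (@block_final M)
            (@block_step M)) => c d N /fullK fc /fullK fd hc hd.
rewrite /dfa_accepts /= block_run //=; [|by right|by right].
by apply: hM; [apply: leq_trans (size_blocks fc) _|apply: leq_trans (size_blocks fd) _];
  rewrite leq_add2r leq_mul2l ?hc ?hd orbT.
Qed.

End Blocks.

(** * Languages given by consecutive letters *)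

Section LocalLanguages.
Variables (C : finType) (ini fin : pred C) (e : rel C).

Definition local_lang : set (seq C) :=
  [set c | if c is x :: c' then [&& ini x, path e x c' & fin (last x c')] else false].

Lemma regular_local_lang : regular local_lang.
Proof.
(* None is the start state, Some None a sink, Some (Some x) means that the
   last letter read is x. *)
pose st (s : option (option C)) (y : C) : option (option C) :=
  match s with
  | None => Some (if ini y then Some y else None)
  | Some None => Some None
  | Some (Some x) => Some (if e x y then Some y else None)
  end.
pose acc (s : option (option C)) := if s is Some (Some x) then fin x else false.
exists (Dfa None acc st); apply/seteqP.
have sink c : foldl st (Some None) c = Some None by elim: c.
have live x c : acc (foldl st (Some (Some x)) c) = path e x c && fin (last x c).
  by elim: c x => //= y c IH x; case: (e x y); rewrite ?sink ?IH.
suff h c : local_lang c = dfa_accepts (Dfa None acc st) c :> Prop.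
  by split=> c /=; rewrite h.
case: c => //= x c; rewrite /dfa_accepts /=.
by case: (ini x); rewrite ?sink ?live.
Qed.

End LocalLanguages.

(** * Multiplication relations *)

Section AdjoinedIdentityTheory.
Variable S : semigroupType.
Implicit Types x y z : option S.

Lemma mul1A : associative (@mul1 S).
Proof. by move=> [a|] [b|] [c|] //=; rewrite mulgA. Qed.

Local Arguments mul1 : simpl never.

Lemma mul1x x : mul1 None x = x. Proof. by []. Qed.

Lemma mulx1 x : mul1 x None = x. Proof. by case: x. Qed.

Lemma mul1_None x y : mul1 x y = None -> x = None /\ y = None.
Proof. by case: x; case: y. Qed.

Lemma eval_cat (A : finType) (gen : A -> S) u v :
  eval_word gen (u ++ v) = mul1 (eval_word gen u) (eval_word gen v).
Proof. by elim: u => //= a u ->; rewrite mul1A. Qed.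

Lemma eval_cons_Some (A : finType) (gen : A -> S) a u :
  exists s, eval_word gen (a :: u) = Some s.
Proof. by rewrite /=; case: (eval_word gen u) => [s|]; eexists. Qed.

End AdjoinedIdentityTheory.

Local Arguments mul1 : simpl never.

Section MultiplicationRelations.
Variables (S : semigroupType) (A : finType) (gen : A -> S) (L : set (seq A)).

Definition mul_rel (x : option S) : set (seq A * seq A) :=
  [set uv | [/\ L uv.1, L uv.2 &
     mul1 (eval_word gen uv.1) x = eval_word gen uv.2]].

Lemma mult_rel_mul_rel w : mult_rel gen L w = mul_rel (eval_word gen w).
Proof.
by apply/seteqP; split=> -[u v] [/= ? ? h]; split=> //=;
  rewrite ?eval_cat // -eval_cat.
Qed.

(** Every element of S has a representative in L, so right multiplication by a
    word can be carried out letter by letter without leaving L. *)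
Lemma sync_mul_rel x : automatic_structure gen L -> sync_regular (mul_rel x).
Proof.
case=> noL evL regL reg0 regA.
have onL s : exists2 w, L w & eval_word gen w = Some s.
  have : (eval_word gen @` L) (Some s) by rewrite evL; exists s.
  by case=> w; exists w.
have [w ->] : exists w, x = eval_word gen w.
  by case: x => [s|]; [have [w _ <-] := onL s; exists w|exists [::]].
elim: w => [|a w IH] {x}.
  by rewrite -mult_rel_mul_rel; apply: sync_of_padded.
have ha : sync_regular (mul_rel (eval_word gen [:: a])).
  by rewrite -mult_rel_mul_rel; apply: sync_of_padded.
rewrite -cat1s eval_cat; move: (eval_word gen w) IH => y IH.
have -> : mul_rel (mul1 (eval_word gen [:: a]) y) =
    rel_comp (mul_rel (eval_word gen [:: a])) (mul_rel y).
  apply/seteqP; split=> -[u v].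
    move=> [/= Lu Lv huv]; case: u Lu huv => // b u Lu huv.
    have [s hs] := eval_cons_Some gen b (u ++ [:: a]).
    have [m Lm hm] := onL s.
    exists m; split; split=> //; rewrite hm -hs -cat_cons eval_cat //=.
    by rewrite -[in LHS]mul1A.
  move=> [m [[Lu Lm hm] [_ Lv hv]]]; split=> //.
  by rewrite -hv -hm -mul1A.
exact: sync_comp.
Qed.

End MultiplicationRelations.

(** * Relative Green relations *)

Section Green.
Variables (S : semigroupType) (T : set S).
Hypothesis mulT : mulg_closed (mem T).
Implicit Types (s t u v : S) (x y : option S).

Local Notation T1 := (adjoin1 T).

Lemma adjoin1_Some t : T1 (Some t) <-> T t.
Proof. by split=> [[//|[s h [<-]]]|h] //; right; exists t. Qed.

Lemma adjoin1_mul x y : T1 x -> T1 y -> T1 (mul1 x y).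
Proof.
case: x y => [s|] [t|] //= /adjoin1_Some hs /adjoin1_Some ht.
by apply/adjoin1_Some/set_mem; apply: mulT; apply/mem_set.
Qed.

Lemma greenR_mul u v : greenR T u v -> exists2 t, T1 t & Some u = mul1 (Some v) t.
Proof.
have : right_translates T u (Some u) by exists None; rewrite ?mulx1 //; left.
by move=> + h; rewrite h => -[t ht e]; exists t.
Qed.

Lemma greenL_mul u v : greenL T u v -> exists2 t, T1 t & Some u = mul1 t (Some v).
Proof.
have : left_translates T u (Some u) by exists None => //; left.
by move=> + h; rewrite h => -[t ht e]; exists t.
Qed.

(** The elements of u T^1 lie in T as soon as u does, so an R^T-class meeting T
    is contained in T. *)
Lemma greenR_subset u v : greenR T u v -> T v -> T u.
Proof.
by move=> /greenR_mul[t ht e] hv; apply/adjoin1_Some; rewrite e;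
  apply: adjoin1_mul => //; apply/adjoin1_Some.
Qed.

Lemma greenL_subset u v : greenL T u v -> T v -> T u.
Proof.
by move=> /greenL_mul[t ht e] hv; apply/adjoin1_Some; rewrite e;
  apply: adjoin1_mul => //; apply/adjoin1_Some.
Qed.

(** For any y in S^1, right multiplication by y maps T^1 u onto T^1 (u y); so L^T
    is compatible with multiplication by all of S, not just by T. *)
Lemma greenL_congr u v u' v' y : greenL T u v ->
  mul1 (Some u) y = Some u' -> mul1 (Some v) y = Some v' -> greenL T u' v'.
Proof.
have tr w w' : mul1 (Some w) y = Some w' ->
    left_translates T w' = (fun x => mul1 x y) @` left_translates T w.
  move=> e; apply/seteqP; split=> z.
    by move=> [t ht <-]; exists (mul1 t (Some w)); [exists t|rewrite -mul1A e].
  by move=> [_ [t ht <-] <-]; exists t; rewrite // -mul1A e.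
by move=> h /tr hu /tr hv; rewrite /greenL hu hv h.
Qed.

Lemma finite_representatives : finite_green_index T ->
  exists n (r : 'I_n -> S), (forall i, ~ T (r i)) /\
    forall u, ~ T u -> exists i, greenH T u (r i).
Proof.
pose cl u : set S := [set v | greenH T u v].
have clT u : ~ T u -> outer_greenH_classes T (cl u).
  move=> hu; split; first by exists u.
  by move=> v [/greenR_subset h _] /h.
move=> [n /card_set_bijP[f [ffun finj fsurj]]].
have hr (i : 'I_n) : exists u, ~ T u /\ f (cl u) = i.
  have [|C [[u hC] CT] hf] := fsurj i; first exact: ltn_ord.
  by exists u; rewrite -/(cl u) /cl -hC; split=> //; apply: CT; rewrite hC; split.
exists n, (fun i => projT1 (cid (hr i))); split=> [i|u hu].
  by case: cid => v [].
have hi := ffun _ (clT _ hu).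
exists (Ordinal hi); case: cid => v /= [hv].
move/(finj _ _ (mem_set (clT _ hv)) (mem_set (clT _ hu))) => e.
by have : cl v v by []; rewrite e.
Qed.

End Green.

(** * Rewriting words over S into words over T *)

Section Rewriting.
Variables (S : semigroupType) (T : set S).
Hypothesis mulT : mulg_closed (mem T).
Variables (A : finType) (gen : A -> S) (M : dfa A).
Variables (n : nat) (r : 'I_n -> S).
Hypothesis rP : forall i, ~ T (r i).
Hypothesis rE : forall u, ~ T u -> exists i, greenH T u (r i).

Local Notation T1 := (adjoin1 T).
Local Notation eval := (eval_word gen).
Local Notation delta := (foldl (@dfa_step _ M)).

Definition hrep (j : option 'I_n) : option S := omap r j.

(** A state (q, j, k) sits between two letters of a word: q is reached by the
    automaton on the prefix, h_j comes from the suffix, h_k from the prefix. *)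
Definition state : finType := (dfa_state M * option 'I_n * option 'I_n)%type.
Implicit Types (x y : state) (th : option S) (u v w : seq A).

(** Both passes over u at once: tau is emitted by the pass from right to left,
    and the pass from left to right turns it into th. *)
Definition run x u y th : Prop :=
  [/\ T1 th, y.1.1 = delta x.1.1 u &
      exists tau, mul1 (eval u) (hrep y.1.2) = mul1 (hrep x.1.2) tau /\
                  mul1 (hrep x.2) tau = mul1 th (hrep y.2)].

Lemma run_nil x : run x [::] x None.
Proof. by split=> //; [left|exists None; rewrite /= !mulx1]. Qed.

Lemma run_cat x u y th v z th' :
  run x u y th -> run y v z th' -> run x (u ++ v) z (mul1 th th').
Proof.
move=> [ht eq [tau [e1 e2]]] [ht' eq' [tau' [e1' e2']]]; split.
- exact: adjoin1_mul.
- by rewrite foldl_cat -eq.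
exists (mul1 tau tau'); rewrite eval_cat; split.
  by rewrite -mul1A e1' mul1A e1 -mul1A.
by rewrite mul1A e2 -mul1A e2' mul1A.
Qed.

(** At the ends of a word both passes meet: the second starts from the h_j with
    which the first stops, and the outer representatives are 1. *)
Lemma run_eval q j u q' th : run (q, j, j) u (q', None, None) th -> eval u = th.
Proof. by move=> [_ _ [tau /= [e1 e2]]]; move: e1 e2; rewrite !mulx1 => -> ->. Qed.

Definition entry : Type := (A * state * option S)%type.
Implicit Types s : seq entry.

Fixpoint trace x s : Prop :=
  if s is (a, y, th) :: s' then run x [:: a] y th /\ trace y s' else True.

Definition tword s : seq A := [seq e.1.1 | e <- s].
Definition tend x s : state := last x [seq e.1.2 | e <- s].
Definition tval s : option S := foldr (fun e => mul1 e.2) None s.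

Lemma tend_cat x s1 s2 : tend x (s1 ++ s2) = tend (tend x s1) s2.
Proof. by rewrite /tend map_cat last_cat. Qed.

Lemma tval_cat s1 s2 : tval (s1 ++ s2) = mul1 (tval s1) (tval s2).
Proof. by elim: s1 => //= e s1 ->; rewrite mul1A. Qed.

Lemma trace_cat x s1 s2 : trace x (s1 ++ s2) <-> trace x s1 /\ trace (tend x s1) s2.
Proof.
elim: s1 x => [|[[a y] th] s1 IH] x /=; first by split=> [|[]].
by rewrite IH; split=> [[? []]|[[]]].
Qed.

Lemma trace_run x s : trace x s -> run x (tword s) (tend x s) (tval s).
Proof.
elim: s x => [|[[a y] th] s IH] x /=; first by move=> _; apply: run_nil.
by move=> [h /IH]; apply: (run_cat h).
Qed.

(** Invariant of the pass from left to right, where z is the prefix read so far: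
    k = None forever after z has entered T, and before that k names the L^T-class
    of z. *)
Definition tracks (k : option 'I_n) (z : option S) : Prop :=
  k = None \/ exists i t, [/\ k = Some i, z = Some t, ~ T t & greenL T t (r i)].

Lemma absorb_letter a j : exists j' tau,
  T1 tau /\ mul1 (Some (gen a)) (hrep j) = mul1 (hrep j') tau.
Proof.
have [t ->] : exists t, mul1 (Some (gen a)) (hrep j) = Some t.
  by case: j => [i|]; eexists.
have [ht|ht] := pselect (T t).
  by exists None, (Some t); split=> //; apply/adjoin1_Some.
have [i [/greenR_mul[tau htau ->] _]] := rE ht.
by exists (Some i), tau.
Qed.

(** Since z and h_k are L^T-related, z tau lies in T iff h_k tau does; so the
    state alone detects the moment when the prefix enters T. *)
Lemma advance k tau z : T1 tau -> tracks k z -> exists k' th,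
  [/\ T1 th, mul1 (hrep k) tau = mul1 th (hrep k') & tracks k' (mul1 z tau)].
Proof.
move=> htau [->|[i [t [-> -> hT hL]]]].
  by exists None, tau; split=> //; [rewrite mulx1|left].
have [t' et'] : exists t', mul1 (Some (r i)) tau = Some t'
  by case: tau {htau} => [a|]; eexists.
have [t2 et2] : exists t2, mul1 (Some t) tau = Some t2
  by case: tau {htau et'} => [a|]; eexists.
rewrite /= et' et2.
have [hT'|hT'] := pselect (T t').
  by exists None, (Some t'); split; [apply/adjoin1_Some| |left].
have [i' [_ hL']] := rE hT'.
have [th hth ->] := greenL_mul hL'.
exists (Some i'), th; split=> //; right; exists i', t2; split=> //.
  move=> h2; apply: hT'; apply: greenL_subset h2 => //.
  by apply: greenL_congr et' et2; rewrite /greenL hL.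
by have h := greenL_congr hL et2 et'; rewrite /greenL h hL'.
Qed.

(** The first pass goes from right to left, the second the other way; quantifying
    over all starting points of the second lets one induction on w build both. *)
Lemma trace_exists w : exists j tau, [/\ T1 tau, eval w = mul1 (hrep j) tau &
  forall q k z, tracks k z -> exists s k',
    [/\ trace (q, j, k) s, tword s = w, tend (q, j, k) s = (delta q w, None, k') &
        tracks k' (mul1 z tau)]].
Proof.
elim: w => [|a w [j [tau [htau e IH]]]].
  exists None, None; split=> //; first by left.
  by move=> q k z hk; exists [::], k; rewrite mulx1.
have [j' [tau1 [htau1 e1]]] := absorb_letter a j.
exists j', (mul1 tau1 tau); split; first exact: adjoin1_mul.
  by rewrite /= e mul1A e1 mul1A.
move=> q k z hk.
have [k1 [th [hth e2 hk1]]] := advance htau1 hk.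
have [s [k' [h1 h2 h3 h4]]] := IH (dfa_step q a) _ _ hk1.
exists ((a, (dfa_step q a, j, k1), th) :: s), k'; split=> //=.
- by split=> //; split=> //; exists tau1.
- by rewrite h2.
- by rewrite mul1A.
Qed.

(** The prefix read at the end is w itself; as it lies in T, the last index of the
    second pass must be that of 1. *)
Lemma trace_of_word w t : eval w = Some t -> T t -> exists j s,
  [/\ trace (dfa_init M, j, j) s, tword s = w, tval s = Some t &
      tend (dfa_init M, j, j) s = (delta (dfa_init M) w, None, None)].
Proof.
move=> ew ht; have [j [tau [_ e h]]] := trace_exists w.
have [|s [k' [h1 h2 h3]]] := h (dfa_init M) j (hrep j).
  case: j {e h} => [i|]; [right|by left].
  by exists i, (r i); split.
rewrite -e ew => -[hk|[i [t' [_ [<-]]]] //].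
rewrite hk in h3; exists j, s; split=> //.
by have := trace_run h1; rewrite h3 h2 => /run_eval <-.
Qed.

(** * Shortest traces *)

(** The competing traces have the same ends and the same value, but may spell
    other words. *)
Definition geodesic x s : Prop := forall s', trace x s' -> tend x s' = tend x s ->
  tval s' = tval s -> size s <= size s'.

Local Notation p := #|state|.

Lemma tval_None s1 s2 : tval (s1 ++ s2) = None -> tval s1 = None /\ tval s2 = None.
Proof. by rewrite tval_cat => /mul1_None. Qed.

(** A stretch of p letters passes through p + 1 states, so one of them repeats;
    when the stretch has value 1, so has the loop, and removing it preserves the
    ends and the value. *)
Lemma geodesic_block x s1 s2 s3 : trace x (s1 ++ s2 ++ s3) ->
  geodesic x (s1 ++ s2 ++ s3) -> size s2 = p -> tval s2 <> None.
Proof.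
move=> htr hg hp h2.
pose f (i : 'I_p.+1) := tend x (s1 ++ take i s2).
have /injectivePn[i [j nij efij]] : ~~ injectiveb f.
  by apply/negP => /injectiveP /leq_card; rewrite card_ord ltnn.
wlog ij : i j nij efij / i < j.
  move=> H; case: (ltngtP i j) nij => [hij|hij|/val_inj ->]; last by rewrite eqxx.
    by move=> nij; apply: (H i j).
  by rewrite eq_sym => nij; apply: (H j i).
have hj : j <= size s2 by rewrite hp -ltnS.
have e2 : s2 = take i s2 ++ drop i (take j s2) ++ drop j s2.
  by rewrite catA -(take_takel _ (ltnW ij)) !cat_take_drop.
(* The loop b leads from position i to position j of s2. *)
set a := take i s2 in e2; set b := drop i (take j s2) in e2; set c := drop j s2 in e2.
have eb : tend x (s1 ++ a) = tend x ((s1 ++ a) ++ b).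
  rewrite -catA; have -> : a ++ b = take j s2; last exact: efij.
  by rewrite /a -(take_takel _ (ltnW ij)) cat_take_drop.
have := h2; rewrite e2 => /tval_None[_ /tval_None[vb _]].
have es : s1 ++ s2 ++ s3 = (s1 ++ a) ++ b ++ (c ++ s3) by rewrite [in LHS]e2 !catA.
rewrite es in htr hg.
have : size ((s1 ++ a) ++ b ++ c ++ s3) <= size ((s1 ++ a) ++ c ++ s3); first apply: hg.
- move/trace_cat: htr => [ta /trace_cat[_ tc]]; apply/trace_cat; split=> //.
  by rewrite eb tend_cat.
- by rewrite [LHS]tend_cat eb -tend_cat -!catA.
- by rewrite !(tval_cat (s1 ++ a)) (tval_cat b) vb mul1x.
have : 0 < size b by rewrite size_drop size_takel // subn_gt0.
by rewrite !(size_cat (s1 ++ a)) (size_cat b); lia.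
Qed.

(** * The automatic structure of T *)

(** The length bound 2p leaves room for a last block that takes up the remainder,
    which on its own could have value 1. *)
Definition letter_ok (t : state * {bseq (p + p) of A} * state) : bool :=
  `[< exists2 th, T th & run t.1.1 t.1.2 t.2 (Some th) >].

Definition letter : finType := {t | letter_ok t}.

Definition source (c : letter) : state := (val c).1.1.
Definition block (c : letter) : seq A := (val c).1.2.
Definition target (c : letter) : state := (val c).2.

Lemma letter_valueP (c : letter) :
  exists th : subsemigroup_type mulT,
    run (source c) (block c) (target c) (Some (val th)).
Proof.
case: c => t ht; have /asboolP[th h1 h2] := ht.
by exists (exist _ th (mem_set h1)).
Qed.

Definition value (c : letter) : subsemigroup_type mulT :=
  projT1 (cid (letter_valueP c)).

Lemma valueP c : run (source c) (block c) (target c) (Some (val (value c))).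
Proof. by rewrite /value; case: cid. Qed.

Definition linked (c d : letter) : bool :=
  (target c == source d) && (size (block c) == p).

Definition initial (c : letter) : bool :=
  ((source c).1.1 == dfa_init M) && ((source c).1.2 == (source c).2).

Definition final (c : letter) : bool :=
  [&& dfa_final (target c).1.1, (target c).1.2 == None & (target c).2 == None].

Definition block_lang : set (seq letter) := local_lang initial final linked.

Lemma size_block c : size (block c) <= p + p.
Proof. exact: size_bseq. Qed.

Definition oval (o : option (subsemigroup_type mulT)) : option S := omap val o.

Lemma oval_mul a b : oval (mul1 a b) = mul1 (oval a) (oval b).
Proof. by case: a; case: b. Qed.

Lemma oval_inj : injective oval.
Proof. by move=> [a|] [b|] //= [/val_inj ->]. Qed.

(** Runs compose, whichever values were chosen for the letters. *)
Lemma path_run c cs : path linked c cs ->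
  run (source c) (blocks block (c :: cs)) (target (last c cs))
      (oval (eval_word value (c :: cs))).
Proof.
elim: cs c => [|d cs IH] c.
  by move=> _; rewrite /blocks /= cats0; apply: valueP.
move=> /= /andP[/andP[/eqP e _]] /IH h; rewrite /= oval_mul.
by apply: run_cat (valueP c) _; rewrite e.
Qed.

Lemma block_lang_sound c : block_lang c ->
  dfa_accepts M (blocks block c) /\ eval (blocks block c) = oval (eval_word value c).
Proof.
case: c => //= c cs /and3P[/andP[/eqP q0 /eqP hj] hp /and3P[hf /eqP k1 /eqP k2]].
have h := path_run hp.
case hs : (source c) hj q0 h => [[q j] k] /= -> -> h.
case ht : (target _) hf k1 k2 h => [[q' j'] k'] /= hf -> -> h; split.
  by case: h => _ /= e _; rewrite /dfa_accepts -e.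
exact: run_eval h.
Qed.

Lemma block_lang_full : block_lang `<=` [set c | full_blocks block p c].
Proof.
case=> //= c cs /and3P[_ h _]; rewrite /full_blocks /=.
by apply: sub_path h => a b /andP[].
Qed.

(** Cut off blocks of length p as long as more than 2p letters remain: then at
    least p letters always stay, which gives the last block a value in T. *)
Lemma blocks_of_trace x s : trace x s ->
  (forall s1 s2 s3, s = s1 ++ s2 ++ s3 -> size s2 = p -> tval s2 <> None) ->
  p <= size s \/ tval s <> None ->
  exists c cs, [/\ source c = x, path linked c cs, target (last c cs) = tend x s &
                   blocks block (c :: cs) = tword s].
Proof.
have [m] := ubnP (size s); elim: m x s => // m IH x s hm htr hfac hs.
have p0 : 0 < p by apply/card_gt0P; exists x.
have single s' : trace x s' -> size s' <= p + p -> tval s' <> None ->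
    exists c, [/\ source c = x, target c = tend x s' & block c = tword s'].
  move=> htr' sz hv; have h := trace_run htr'.
  have sz' : size (tword s') <= p + p by rewrite size_map.
  have ok : letter_ok (x, Bseq sz', tend x s').
    apply/asboolP; case: (tval s') hv h => // th _ h.
    by exists th => //; apply/adjoin1_Some; case: h.
  by exists (Sub _ ok).
have nz : tval s <> None.
  case: hs => // ps e; apply: (hfac [::] (take p s) (drop p s)).
  - by rewrite /= cat_take_drop.
  - exact: size_takel.
  by move: e; rewrite -{1}(cat_take_drop p s) => /tval_None[].
case: (leqP (size s) (p + p)) => sz.
  have [c [h1 h2 h3]] := single s htr sz nz.
  by exists c, [::]; split=> //; rewrite /blocks /= cats0.
have ps : p <= size s by lia.
have es := cat_take_drop p s.
have [tr1 tr2] : trace x (take p s) /\ trace (tend x (take p s)) (drop p s).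
  by apply/trace_cat; rewrite es.
have [||c [c1 c2 c3]] := single _ tr1.
- by rewrite size_takel // leq_addr.
- by apply: (hfac [::] _ (drop p s)); rewrite ?size_takel.
have [||||d [cs [d1 d2 d3 d4]]] := IH (tend x (take p s)) (drop p s).
- by rewrite size_drop; lia.
- exact: tr2.
- by move=> s1 s2 s3 e; apply: (hfac (take p s ++ s1) _ s3); rewrite -catA -e.
- by left; rewrite size_drop; lia.
exists c, (d :: cs); split=> //=.
- by rewrite d2 /linked c2 d1 eqxx c3 size_map size_takel ?eqxx.
- by rewrite d3 -tend_cat es.
by rewrite -[in RHS]es /tword map_cat -!/(tword _) -c3 -d4.
Qed.

(** The word found here spells a shortest trace with value t, in general not a
    trace of w. *)
Lemma block_lang_complete w t : dfa_accepts M w -> eval w = Some t -> T t ->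
  exists2 c, block_lang c & oval (eval_word value c) = Some t.
Proof.
move=> hw ew ht.
pose good m := exists x s, [/\ size s = m, trace x s, tval s = Some t,
  x.1.1 = dfa_init M /\ x.1.2 = x.2 &
  [&& dfa_final (tend x s).1.1, (tend x s).1.2 == None & (tend x s).2 == None]].
have ex : exists m, `[< good m >].
  have [j [s [h1 h2 h3 h4]]] := trace_of_word ew ht.
  exists (size s); apply/asboolP; exists (dfa_init M, j, j), s.
  by rewrite h4 /= !andbT.
case: (ex_minnP ex) => m /asboolP[x [s [sm htr hv [x1 x2] hf]]] hmin.
have geo : geodesic x s.
  move=> s' t1 t2 t3; rewrite sm; apply: hmin; apply/asboolP; exists x, s'.
  by rewrite t2 t3.
have [||c [cs [c1 c2 c3 c4]]] := blocks_of_trace htr.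
- by move=> s1 s2 s3 e; apply: (@geodesic_block x s1 s2 s3); rewrite -e.
- by right; rewrite hv.
have hc : block_lang (c :: cs).
  by rewrite /block_lang /= /initial /final c1 c2 c3 x1 x2 !eqxx.
exists (c :: cs) => //; have [_ <-] := block_lang_sound hc.
rewrite c4 -hv; have := trace_run htr.
case: (x) x1 x2 hf => [[q j] k] /= _ <-; case: (tend _ s) => [[q' j'] k'] /=.
by move=> /and3P[_ /eqP -> /eqP ->] /run_eval.
Qed.

(** Words of K and their concatenated blocks represent the same element, so each
    multiplication relation of K is the pull-back of one of L. *)
Lemma block_lang_automatic :
  automatic_structure gen [set w | dfa_accepts M w] ->
  automatic_structure value block_lang.
Proof.
move=> autA; have [_ evL _ _ _] := autA.
have regK : regular block_lang by apply: regular_local_lang.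
have reg_mult (w : seq letter) : regular (padded_lang (mult_rel value block_lang w)).
  apply: padded_of_sync.
  have := sync_blocks size_block regK block_lang_full
    (sync_mul_rel (oval (eval_word value w)) autA).
  congr sync_regular; apply/seteqP; split=> -[c d] [/= Kc Kd].
    have [_ ec] := block_lang_sound Kc; have [_ ed] := block_lang_sound Kd.
    rewrite /mul_rel /= ec ed -oval_mul -eval_cat => -[_ _ /oval_inj].
    by split.
  have [Lc ec] := block_lang_sound Kc; have [Ld ed] := block_lang_sound Kd.
  move=> e; split=> //; split=> //=.
  by rewrite ec ed -oval_mul -eval_cat e.
split=> //.
apply/seteqP; split=> [_ [[|c cs] // _ <-]|_ [t _ <-]].
  by have [t ->] := eval_cons_Some value c cs; exists t.
have : (eval @` [set w | dfa_accepts M w]) (Some (val t))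
  by rewrite evL; exists (val t).
move=> [w hw ew].
have [|c hc e] := block_lang_complete hw ew; first exact: set_mem (valP t).
by exists c => //; apply: oval_inj.
Qed.

End Rewriting.

Theorem theorem10p1 (S : semigroupType) (T : set S) (mulT : mulg_closed (mem T)) :
  finite_green_index T -> automatic S -> automatic (subsemigroup_type mulT).
Proof.
move=> /(finite_representatives mulT)[n [r [rP rE]]] [A [gen [L autL]]].
have [_ _ [M eL] _ _] := autL.
have := block_lang_automatic mulT rP rE (gen := gen) (M := M).
rewrite -eL => /(_ autL) h.
exact: (ex_intro _ _ (ex_intro _ _ (ex_intro _ _ h))).
Qed.
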